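(* Let $(\mathcal{M},d)$ be a Cartan-Hadamard manifold and let $S\subset\mathcal{M}$ be g-convex. Suppose $f:S\to\mathbb{R}$ is g-convex. If $h:\mathbb{R}\to\mathbb{R}$ is non-decreasing and convex (in the usual Euclidean sense), then $h\circ f:S\to\mathbb{R}$ is g-convex.
   Context: A Cartan-Hadamard manifold is a Riemannian manifold of non-positive sectional curvature in which every pair of points is connected by a unique geodesic, which is distance-minimizing; $d$ is the Riemannian distance. A set $S\subseteq\mathcal{M}$ is geodesically convex (g-convex) if for any $x,y\in S$ there is a geodesic $\gamma:[0,1]\to\mathcal{M}$ with $\gamma(0)=x$, $\gamma(1)=y$ and $\gamma([0,1])\subseteq S$. A function $f:S\to\mathbb{R}$ is g-convex if $S$ is g-convex and $f\circ\gamma:[0,1]\to\mathbb{R}$ is convex in the usual sense for each geodesic segment $\gamma:[0,1]\to\mathcal{M}$ with image in $S$ and $\gamma(0)\ne\gamma(1)$. All functions considered are assumed continuous. *)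

(* Defs.v *)
From HB Require Import structures.
From mathcomp Require Import all_boot all_order all_algebra.
From mathcomp Require Import all_classical all_reals all_analysis.

Set Implicit Arguments.
Unset Strict Implicit.
Unset Printing Implicit Defensive.

Import Order.TTheory GRing.Theory Num.Theory numFieldNormedType.Exports.

Local Open Scope classical_set_scope.
Local Open Scope ring_scope.

Section Smooth.
Context {R : realType} {n : nat}.

Definition basis_vec (a : 'I_n) : 'rV[R]_n := delta_mx ord0 a.

(* Meant for an open set U: all iterated partial derivatives up to order k
   exist and are continuous on U. *)
Fixpoint Ck_on (k : nat) (W : normedModType R) (U : set 'rV[R]_n)
    (F : 'rV[R]_n -> W) : Prop :=
  (forall v, U v -> {for v, continuous F}) /\
  match k with
  | 0 => True
  | k'.+1 => forall a : 'I_n,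
      (forall v, U v -> derivable F v (basis_vec a)) /\
      Ck_on k' U (fun v => 'D_(basis_vec a) F v)
  end.

Definition smooth_on (W : normedModType R) (U : set 'rV[R]_n)
    (F : 'rV[R]_n -> W) : Prop := forall k, Ck_on k U F.

End Smooth.

(* The charts are those of some smooth atlas, not necessarily maximal.  The maps
   [coord i] and [point i] are total, but meaningful only on [dom i] and on its
   image.  [chart_at] selects a chart around each point. *)
Record smooth_manifold (R : realType) (n : nat) (M : topologicalType) := {
  chart : Type;
  dom : chart -> set M;
  coord : chart -> M -> 'rV[R]_n;
  point : chart -> 'rV[R]_n -> M;
  chart_at : M -> chart;
  manifold_hausdorff : hausdorff_space M;
  manifold_second_countable : @second_countable M;
  dom_open : forall i, open (dom i);
  codom_open : forall i, open (coord i @` dom i);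
  coordK : forall i x, dom i x -> point i (coord i x) = x;
  coord_continuous : forall i x, dom i x -> {for x, continuous (coord i)};
  point_continuous : forall i v,
    (coord i @` dom i) v -> {for v, continuous (point i)};
  chart_atP : forall x, dom (chart_at x) x;
  transition_smooth : forall i j,
    smooth_on (coord i @` (dom i `&` dom j)) (coord j \o point i)
}.

(* [metric i v] is the matrix of the metric in the chart i at the coordinates v.
   Tangent vectors are row vectors, and u in the chart i becomes
   u *m jacobian (coord j \o point i) v in the chart j. *)
Record riemannian_manifold (R : realType) (n : nat) (M : topologicalType) := {
  manifold :> smooth_manifold R n M;
  metric : chart manifold -> 'rV[R]_n -> 'M[R]_n;
  metric_smooth : forall i, smooth_on (coord i @` dom i) (metric i);
  metric_sym : forall (i : chart manifold) v, (coord i @` dom i) v ->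
    (metric i v)^T = metric i v;
  metric_pos : forall (i : chart manifold) v (u : 'rV[R]_n),
    (coord i @` dom i) v -> u != 0 ->
    0 < (u *m metric i v *m u^T) ord0 ord0;
  metric_transition : forall (i j : chart manifold) x, dom i x -> dom j x ->
    let J := jacobian (coord j \o point i) (coord i x) in
    metric i (coord i x) = J *m metric j (coord j x) *m J^T
}.

Section Riemannian.
Context {R : realType} {n : nat} {M : topologicalType}.
Variable G : riemannian_manifold R n M.
Implicit Types (i : chart G) (v u w z : 'rV[R]_n) (gam : R -> M) (S : set M).

Definition inner i v u w : R := (u *m metric i v *m w^T) ord0 ord0.

Definition partial (a : 'I_n) (F : 'rV[R]_n -> R) v : R :=
  'D_(basis_vec a) F v.

(* Gamma^c_(a b) *)
Definition christoffel i (c a b : 'I_n) v : R :=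
  2^-1 * \sum_(d < n) invmx (metric i v) c d *
    (partial a (fun v => metric i v b d) v
     + partial b (fun v => metric i v a d) v
     - partial d (fun v => metric i v a b) v).

(* The component along e_d of R(e_a, e_b) e_c, with the convention
   R(X, Y) Z = D_X (D_Y Z) - D_Y (D_X Z) - D_[X, Y] Z. *)
Definition curvature_coef i v (d c a b : 'I_n) : R :=
  partial a (christoffel i d b c) v - partial b (christoffel i d a c) v
  + \sum_(e < n) (christoffel i d a e v * christoffel i e b c v
                  - christoffel i d b e v * christoffel i e a c v).

Definition curvature i v u w z : 'rV[R]_n :=
  \row_d \sum_(a < n) \sum_(b < n) \sum_(c < n)
    u ord0 a * w ord0 b * z ord0 c * curvature_coef i v d c a b.

(* Meaningful only when u and w are linearly independent. *)
Definition sectional_curvature i v u w : R :=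
  inner i v (curvature i v u w w) u /
  (inner i v u u * inner i v w w - inner i v u w ^+ 2).

Definition nonpositive_sectional_curvature : Prop :=
  forall i v u w, (coord i @` dom i) v -> row_free (col_mx u w) ->
    sectional_curvature i v u w <= 0.

Definition in_chart i gam : R -> 'rV[R]_n := coord i \o gam.

Definition geodesic_on (a b : R) gam : Prop :=
  forall t : R, a < t < b ->
    {for t, continuous gam} /\
    forall i, dom i (gam t) ->
      let c := in_chart i gam in
      [/\ derivable c t 1, derivable (derive1 c) t 1 &
        forall d : 'I_n,
          (derive1 (derive1 c) t) ord0 d +
          \sum_(a < n) \sum_(b < n) christoffel i d a b (c t)
            * (derive1 c t) ord0 a * (derive1 c t) ord0 b = 0].

(* A curve [0, 1] -> M is represented by a map R -> M of which only the
   restriction to [0, 1] matters.  As usual, regularity on a closed interval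
   means that of some extension to a larger open interval. *)
Definition geodesic gam : Prop :=
  exists (e : R) (gam' : R -> M),
    [/\ 0 < e, geodesic_on (- e) (1 + e) gam' &
      forall t : R, 0 <= t <= 1 -> gam t = gam' t].

Definition C1_on (a b : R) gam : Prop :=
  forall t : R, a < t < b ->
    {for t, continuous gam} /\
    forall i, dom i (gam t) ->
      derivable (in_chart i gam) t 1 /\
      {for t, continuous (derive1 (in_chart i gam))}.

Inductive piecewise_C1 gam : R -> R -> Prop :=
| piecewise_C1_piece (a b e : R) (gam' : R -> M) of
    a < b & 0 < e & C1_on (a - e) (b + e) gam' &
    (forall t : R, a <= t <= b -> gam t = gam' t) : piecewise_C1 gam a b
| piecewise_C1_concat (a b c : R) of
    piecewise_C1 gam a b & piecewise_C1 gam b c : piecewise_C1 gam a c.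

Definition speed gam (t : R) : R :=
  let i := chart_at G (gam t) in
  let c := in_chart i gam in
  Num.sqrt (inner i (c t) (derive1 c t) (derive1 c t)).

Definition curve_length gam : R :=
  (\int[lebesgue_measure]_(t in `[0%R, 1%R]) speed gam t)%R.

Definition riemannian_distance (x y : M) : R :=
  inf [set curve_length gam | gam in
        [set gam | [/\ piecewise_C1 gam 0 1, gam 0 = x & gam 1 = y]]].

Definition cartan_hadamard : Prop :=
  nonpositive_sectional_curvature /\
  forall x y : M, exists gam : R -> M,
    [/\ [/\ geodesic gam, gam 0 = x & gam 1 = y],
        forall gam', geodesic gam' -> gam' 0 = x -> gam' 1 = y ->
          forall t : R, 0 <= t <= 1 -> gam' t = gam t &
        curve_length gam = riemannian_distance x y].

Definition gconvex_set S : Prop :=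
  forall x y, S x -> S y -> exists gam : R -> M,
    [/\ geodesic gam, gam 0 = x, gam 1 = y &
      forall t : R, 0 <= t <= 1 -> S (gam t)].

(* A function S -> R is represented by a map M -> R of which only the
   restriction to S matters; functions are continuous by convention. *)
Definition gconvex_fun S (f : M -> R) : Prop :=
  [/\ {within S, continuous f}, gconvex_set S &
    forall gam : R -> M, geodesic gam ->
      (forall t : R, 0 <= t <= 1 -> S (gam t)) -> gam 0 <> gam 1 ->
      @convex_function R R^o `[0, 1] (f \o gam)].

End Riemannian.

(* Main.v *)
Require Import Defs.
From mathcomp Require Import all_boot all_order all_algebra.
From mathcomp Require Import all_classical all_reals all_analysis.

Set Implicit Arguments.
Unset Strict Implicit.
Unset Printing Implicit Defensive.

Import Order.TTheory GRing.Theory Num.Theory numFieldNormedType.Exports.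

Local Open Scope classical_set_scope.
Local Open Scope ring_scope.

Theorem proposition5 (R : realType) (n : nat) (M : topologicalType)
    (G : riemannian_manifold R n M) (S : set M) (f : M -> R) (h : R -> R) :
  cartan_hadamard G ->
  gconvex_set G S ->
  gconvex_fun G S f ->
  continuous h ->
  {homo h : x y / x <= y} ->
  @convex_function R R^o setT h ->
  gconvex_fun G S (h \o f).
Proof.
move=> _ Sconv [f_cont _ f_conv] h_cont h_homo h_conv; split=> //.
  (* Continuity within [S] is continuity for the subspace topology, so it composes pointwise with
     that of [h]. *)
  by move=> x; apply: (continuous_comp (f_cont x)); exact: h_cont.
move=> gam gam_geo gamS gam01 t x y x01 y01.
(* Convexity of [h] bounds the right-hand side below by [h] of the convex combination of [f (gam x)]
   and [f (gam y)]. *)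
apply: le_trans (h_conv t _ _ (in_setT _) (in_setT _)).
(* Monotonicity of [h] carries the convexity inequality of [f] along the geodesic through [h]. *)
exact: h_homo (f_conv gam gam_geo gamS gam01 t x y x01 y01).
Qed.
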